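(* Let $q$ be a transcendental complex number and let $(r_i,s_i)_{1\le i\le v}$, $(t_j,u_j)_{1\le j\le w}$ be pairs of integers with all $s_i,u_j$ nonzero, such that the sequence $Q_{\mathbf r,\mathbf t}(q;n):=\prod_{i=1}^v(q^{r_i};q^{s_i})_n/\prod_{j=1}^w(q^{t_j};q^{u_j})_n$, $n\ge0$, is well-defined and not eventually zero. Then the following are equivalent: (i) there exists $C(q)\in\mathbb Z[q]\setminus\{0\}$ such that $C(q)^nQ_{\mathbf r,\mathbf t}(q;n)\in\mathbb Z[q^{-1},q]$ for every $n\ge0$; (ii) for every $b\in\{1,\dots,d_{\mathbf r,\mathbf t}\}$ and every $x\in\mathbb R$, $\Xi_{\mathbf r,\mathbf t}(b,x)\ge0$.
   Context: $(q^r;q^s)_n:=\prod_{i=0}^{n-1}(1-q^{r+si})$ for $n\ge0$. Write $\alpha_i:=r_i/s_i$, $\beta_j:=t_j/u_j$. $\langle x\rangle$ is the fractional part of $x$ if $x\notin\mathbb Z$ and $1$ if $x\in\mathbb Z$; Christol order: $x\preceq y$ iff $\langle x\rangle<\langle y\rangle$ or ($\langle x\rangle=\langle y\rangle$ and $x\ge y$). $d_{\mathbf r,\mathbf t}$ is the positive lcm of $s_1,\dots,s_v,u_1,\dots,u_w$. For $b\in\{1,\dots,d_{\mathbf r,\mathbf t}\}$: $c_i:=\gcd(r_i,s_i,b)$, $d_j:=\gcd(t_j,u_j,b)$, $V_b:=\{i:\gcd(s_i,b)=c_i\}$, $W_b:=\{j:\gcd(u_j,b)=d_j\}$; for $i\in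 V_b,j\in W_b$ choose positive integers $e_i,f_j$ with $be_i\equiv c_i\pmod{s_i}$, $bf_j\equiv d_j\pmod{u_j}$; $\tilde b$ is the greatest divisor of $b$ coprime to $d_{\mathbf r,\mathbf t}$ and $a\in\{1,\dots,d_{\mathbf r,\mathbf t}\}$ satisfies $a\tilde b\equiv1\pmod{d_{\mathbf r,\mathbf t}}$. Then $\Xi_{\mathbf r,\mathbf t}(b,x):=\#\{(i,k)\in V_b\times\{0,\dots,c_i-1\}:\frac{\langle e_i\alpha_i\rangle+k}{c_i}-\lfloor1-a\alpha_i\rfloor\preceq x\}-\#\{(j,\ell)\in W_b\times\{0,\dots,d_j-1\}:\frac{\langle f_j\beta_j\rangle+\ell}{d_j}-\lfloor1-a\beta_j\rfloor\preceq x\}$ (independent of the choice of $e_i,f_j$). *)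

(* Defs.v *)
From HB Require Import structures.
From mathcomp Require Import all_boot all_order all_algebra.
From mathcomp Require Import reals.
From mathcomp Require Import complex.

Set Implicit Arguments.
Unset Strict Implicit.
Unset Printing Implicit Defensive.

Import Order.TTheory GRing.Theory Num.Theory.
Local Open Scope ring_scope.

Section QPochhammer.
Variable R : realType.
Implicit Types (q z : R[i]).

Definition transcendental q : Prop := ~ algebraicOver (ratr : rat -> R[i]) q.

(* (q^r; q^s)_n, with integer (possibly negative) r and s *)
Definition qpoch q (r s : int) (n : nat) : R[i] :=
  \prod_(i < n) (1 - q ^ (r + s * i%:Z)).

Definition Qratio (v w : nat) (r s : 'I_v -> int) (t u : 'I_w -> int) q
    (n : nat) : R[i] :=
  (\prod_(i < v) qpoch q (r i) (s i) n) / (\prod_(j < w) qpoch q (t j) (u j) n).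

(* No denominator vanishes: needed because division by 0 is total here. *)
Definition Qratio_well_defined (w : nat) (t u : 'I_w -> int) q : Prop :=
  forall n, \prod_(j < w) qpoch q (t j) (u j) n != 0.

Definition eventually_zero (a : nat -> R[i]) : Prop :=
  exists N : nat, forall n, (N <= n)%N -> a n = 0.

(* z belongs to the subring Z[q] of the complex numbers *)
Definition in_Zq q z : Prop :=
  exists P : {poly int}, z = (map_poly intr P).[q].

(* z belongs to the subring Z[q^-1, q] of the complex numbers; q is nonzero
   wherever this is used *)
Definition in_ZqV q z : Prop :=
  exists (P : {poly int}) (m : nat), z = (map_poly intr P).[q] / q ^+ m.

End QPochhammer.

Section ChristolOrder.
Variable R : realType.
Implicit Types x y : R.

(* Fractional part, normalised to lie in ]0, 1] *)
Definition cfrac x : R :=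
  if x \is a Num.int then 1 else x - (Num.floor x)%:~R.

Definition christol_le x y : bool :=
  (cfrac x < cfrac y) || ((cfrac x == cfrac y) && (x >= y)).

End ChristolOrder.

Section Xi.
Variables (v w : nat) (r s : 'I_v -> int) (t u : 'I_w -> int).

Definition drt : nat :=
  lcmn (\big[lcmn/1%N]_(i < v) `|s i|%N) (\big[lcmn/1%N]_(j < w) `|u j|%N).

(* gcd(r_i, s_i, b) *)
Definition gcd3 m (r s : 'I_m -> int) (b : nat) (i : 'I_m) : nat :=
  gcdn (gcdn `|r i| `|s i|) b.

(* V_b, and W_b when applied to (t, u) *)
Definition Vset m (r s : 'I_m -> int) (b : nat) : {set 'I_m} :=
  [set i | gcdn `|s i| b == gcd3 r s b i].

Definition btilde (b : nat) : nat :=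
  (\max_(k <- divisors b | coprime k drt) k)%N.

Definition is_a (b a : nat) : Prop :=
  (1 <= a <= drt)%N /\ a * btilde b = 1 %[mod drt].

(* e = (e_i) is an admissible choice for b; values off V_b are irrelevant *)
Definition is_e m (r s : 'I_m -> int) (b : nat) (e : 'I_m -> nat) : Prop :=
  forall i, i \in Vset r s b ->
    (0 < e i)%N /\ (b%:Z * (e i)%:Z = (gcd3 r s b i)%:Z %[mod s i])%Z.

(* The auxiliary data a, e_i always exist, so quantifying over them is never
   vacuous. *)
Lemma drt_gt0 : (forall i, s i != 0) -> (forall j, u j != 0) -> (0 < drt)%N.
Proof.
move=> hs hu; rewrite lcmn_gt0; apply/andP; split;
  elim/big_ind: _ => // [m n m0 n0|i _]; rewrite ?lcmn_gt0 ?m0 ?n0 // absz_gt0.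
  exact: hs.
exact: hu.
Qed.

Lemma is_a_exists b : (0 < drt)%N -> (0 < b)%N -> exists a, is_a b a.
Proof.
move=> d0 b0.
have bt0 : (0 < btilde b)%N.
  rewrite /btilde; apply: (@leq_bigmax_seq _ _ _ (fun k => k) 1%N).
    by rewrite -dvdn_divisors ?dvd1n.
  exact: coprime1n.
have cop : coprime (btilde b) drt.
  have : (btilde b == 0%N) || coprime (btilde b) drt.
    rewrite /btilde; elim/big_ind: _ => [//|x y cx cy|k ->]; last exact: orbT.
    by rewrite /maxn; case: ifP.
  by rewrite eqn0Ngt bt0.
case: (egcdnP drt bt0) => km kn E _.
rewrite (eqP cop) in E.
exists ((km + drt - 1) %% drt).+1; split; first by rewrite /= ltn_pmod.
rewrite -modnMml -addn1 modnDml.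
have -> : (km + drt - 1 + 1 = km + drt)%N by rewrite subnK // addn_gt0 d0 orbT.
by rewrite modnDr modnMml E modnMDl.
Qed.

Lemma is_e_exists m (r0 s0 : 'I_m -> int) b :
  (0 < b)%N -> exists e, is_e r0 s0 b e.
Proof.
move=> b0.
exists (fun i => (egcdn b `|s0 i|%N).1) => i; rewrite inE => /eqP <-.
case: egcdnP => // km kn E _ /=; split.
  have : (0 < km * b)%N by rewrite E addn_gt0 gcdn_gt0 b0 orbT.
  by rewrite muln_gt0 => /andP[].
rewrite -PoszM [(b * _)%N]mulnC E PoszD PoszM gcdnC.
apply/eqP; rewrite eqz_mod_dvd addrK.
by rewrite dvdz_mull // dvdzE abszE.
Qed.

Variable R : realType.

Definition ratio m (r s : 'I_m -> int) (i : 'I_m) : R :=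
  (r i)%:~R / (s i)%:~R.

Definition jump m (r s : 'I_m -> int) (b a : nat) (e : 'I_m -> nat)
    (i : 'I_m) (k : nat) : R :=
  (cfrac ((e i)%:R * ratio r s i) + k%:R) / (gcd3 r s b i)%:R
  - (Num.floor (1 - a%:R * ratio r s i))%:~R.

Definition jump_count m (r s : 'I_m -> int) (b a : nat) (e : 'I_m -> nat)
    (x : R) : nat :=
  #|[set p : {i : 'I_m & 'I_(gcd3 r s b i)} |
      (tag p \in Vset r s b) &&
      christol_le (jump r s b a e (tag p) (tagged p)) x]|.

(* Xi_{r,t}(b, x), computed with the auxiliary data a, (e_i), (f_j) for b *)
Definition Xi (b a : nat) (e : 'I_v -> nat) (f : 'I_w -> nat) (x : R) : int :=
  (jump_count r s b a e x)%:Z - (jump_count t u b a f x)%:Z.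

End Xi.

(* Main.v *)
Require Import Defs.
From HB Require Import structures.
From mathcomp Require Import all_boot all_order all_algebra.
From mathcomp Require Import algC cyclotomic.
From mathcomp Require Import reals.
From mathcomp Require Import complex.
From mathcomp Require Import zify ring lra.

(* Up to units of Z[q^-1, q], Q(n) is a product of cyclotomic polynomials in q,
   and the exponent of the b-th one is the number of k < n with b | r_i + s_i k,
   summed over i, minus the analogous number for (t, u). Hence (i) says that for
   all large b these exponents are nonnegative for every n: the finitely many
   remaining cyclotomic factors have exponent at least -wn and are absorbed by C.
   For large b, the k in [0, b[ with b | r + s k are the numbers
   b (<e alpha> + l) / c - alpha with l < c, where c = gcd(s, b) (there are none
   if c does not divide r). For large b they are ordered first by
   (<e alpha> + l) / c and then by decreasing alpha, which is the Christol order
   of the jumps of Xi; the data c and e depend on b only modulo d. *)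

Set Implicit Arguments.
Unset Strict Implicit.
Unset Printing Implicit Defensive.

Import Order.TTheory GRing.Theory Num.Theory.
Local Open Scope ring_scope.

(** * Multiplicities of roots of unity in products of ['X^m - 1] *)

Definition zero_count m (r s : 'I_m -> int) (b n : nat) : nat :=
  (\sum_(i < m) \sum_(k < n) (b %| `|(r i + s i * k%:Z)%R|))%N.

(** Absolute values keep the exponents natural: as [1 - q^-m = q^-m (q^m - 1)], the value at [q] is
    the product of the q-Pochhammer symbols up to a sign and a power of [q]. *)
Definition cyclo_prod m (r s : 'I_m -> int) (n : nat) : {poly int} :=
  \prod_(i < m) \prod_(k < n) ('X^`|r i + s i * k%:Z| - 1).

Lemma mup_prod (I : Type) (l : seq I) (F : I -> {poly algC}) z :
  (forall i, F i != 0) ->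
  mup z (\prod_(i <- l) F i) = (\sum_(i <- l) mup z (F i))%N.
Proof.
move=> F0; elim: l => [|i l IH]; first by rewrite !big_nil mupNroot ?root1.
rewrite !big_cons mupM ?IH ?F0 //.
by elim/big_ind: _ => [||//]; [exact: oner_neq0 | exact: mulf_neq0].
Qed.

Lemma Xn_sub_1_neq0 (R : nzRingType) m : (0 < m)%N -> 'X^m - 1 != 0 :> {poly R}.
Proof. by move=> m0; rewrite -size_poly_eq0 size_XnsubC. Qed.

(** Roots of ['X^m - 1] are simple, because the derivative [m X^(m-1)] vanishes at no root of
    unity. *)
Lemma mup_Xn_sub_1 (b m : nat) (z : algC) :
  b.-primitive_root z -> (0 < m)%N -> mup z ('X^m - 1) = (b %| m)%N :> nat.
Proof.
move=> zb m0; have [bm|bm] := boolP (b %| m)%N; last first.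
  by apply: mupNroot; rewrite /root !hornerE subr_eq0 -(prim_order_dvd zb).
have rz : root ('X^m - 1) z.
  by rewrite /root !hornerE subr_eq0 -(prim_order_dvd zb).
have [Q EQ] := factor_theorem _ _ rz.
have : (deriv ('X^m - 1 : {poly algC})).[z] = Q.[z].
  by rewrite EQ derivM derivXsubC !hornerE subrr mulr0 add0r.
rewrite derivB derivXn derivC subr0 hornerMn hornerXn => HQ.
have z0 : z != 0 by rewrite (prim_root_eq0 zb) -lt0n (prim_order_gt0 zb).
rewrite EQ mupMr; first by rewrite -[_ - _]expr1 mup_XsubCX eqxx.
by rewrite /root -HQ -mulr_natr mulf_neq0 ?expf_neq0 // pnatr_eq0 -lt0n.
Qed.

Lemma mup_cyclo_prod m (r s : 'I_m -> int) (b n : nat) (z : algC) :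
  b.-primitive_root z -> (forall i (k : nat), r i + s i * k%:Z != 0) ->
  mup z (map_poly intr (cyclo_prod r s n)) = zero_count r s b n.
Proof.
move=> zb hr; rewrite /cyclo_prod rmorph_prod /=.
have N0 i (k : 'I_n) : map_poly intr ('X^`|r i + s i * k%:Z| - 1) != 0 :> {poly algC}.
  by rewrite rmorphB /= rmorph1 map_polyXn Xn_sub_1_neq0 // absz_gt0.
rewrite mup_prod => [|i]; last first.
  by rewrite rmorph_prod prodf_seq_neq0; apply/allP => k _; rewrite N0.
apply: eq_bigr => i _; rewrite rmorph_prod mup_prod; last exact: N0.
apply: eq_bigr => k _; rewrite rmorphB /= rmorph1 map_polyXn.
by rewrite (mup_Xn_sub_1 zb) ?absz_gt0.
Qed.

(* Distinct orders give distinct roots, so a nonzero polynomial is nonzero at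
   primitive roots of unity of some large order in the progression. *)
Lemma prim_root_avoid (c : {poly int}) (b d N0 : nat) :
  c != 0 -> (0 < b)%N -> (0 < d)%N ->
  exists (N : nat) (z : algC), [/\ (N0 <= N)%N, (b + d * N).-primitive_root z &
    ~~ root (map_poly intr c) z].
Proof.
move=> c0 b0 d0.
pose ord k := (b + d * (N0 + k))%N.
have ord0 k : (0 < ord k)%N by rewrite addn_gt0 b0.
pose zeta k : algC := sval (C_prim_root_exists (ord0 k)).
have zetaP k : (ord k).-primitive_root (zeta k).
  by rewrite /zeta; case: C_prim_root_exists.
pose cC : {poly algC} := map_poly intr c.
have cC0 : cC != 0 by rewrite map_poly_eq0_id0 // intr_eq0 lead_coef_eq0.
have injz : injective zeta.
  move=> k l E; have := zetaP l; rewrite -E => pl.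
  have := prim_order_dvd (zetaP k) (ord l); rewrite (prim_expr_order pl) eqxx => kl.
  have := prim_order_dvd pl (ord k); rewrite (prim_expr_order (zetaP k)) eqxx => lk.
  have : ord k = ord l by apply/eqP; rewrite eqn_dvd kl lk.
  by move/addnI/eqP; rewrite eqn_pmul2l // => /eqP/addnI.
(* These [size cC] distinct points are one more than the degree of [cC]. *)
pose rs := [seq zeta k | k <- iota 0 (size cC)].
have [al|/allPn [_ /mapP [k _ ->] nr]] := boolP (all (root cC) rs).
  have := max_poly_roots cC0 al; rewrite map_inj_uniq ?iota_uniq // => /(_ isT).
  by rewrite size_map size_iota ltnn.
by exists (N0 + k)%N, (zeta k); split=> //; rewrite ?leq_addr //; apply: zetaP.
Qed.

(** * Evaluation at [q], and integrality in terms of cyclotomic exponents *)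

Section Evaluation.
Variables (R : realType) (q : R[i]).
Hypothesis hq : transcendental q.

Local Notation ev P := (map_poly intr P).[q].

(** Transcendence makes evaluation at [q] injective on integer polynomials, so identities between
    values lift to [Z[X]], where they can be examined at roots of unity. *)
Lemma ev_eq0 (P : {poly int}) : ev P = 0 -> P = 0.
Proof.
move=> evP; have [->//|P0] := eqVneq P 0; case: hq.
exists (map_poly intr P).
  by rewrite map_poly_eq0_id0 // intr_eq0 lead_coef_eq0.
rewrite /root -map_poly_comp; apply/eqP; rewrite -[RHS]evP; congr (_.[q]).
by apply: eq_map_poly => n /=; rewrite ratr_int.
Qed.

Lemma ev_inj (P Q : {poly int}) : ev P = ev Q -> P = Q.
Proof.
move=> E; apply/eqP; rewrite -subr_eq0; apply/eqP/ev_eq0.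
by rewrite rmorphB hornerD hornerN E subrr.
Qed.

Lemma evM P Q : ev (P * Q) = ev P * ev Q.
Proof. by rewrite rmorphM hornerM. Qed.

Lemma evX P n : ev (P ^+ n) = ev P ^+ n.
Proof. by rewrite rmorphXn horner_exp. Qed.

Lemma ev_Xn n : ev 'X^n = q ^+ n.
Proof. by rewrite map_polyXn hornerXn. Qed.

Lemma ev_prod (I : Type) (l : seq I) (F : I -> {poly int}) :
  ev (\prod_(i <- l) F i) = \prod_(i <- l) ev (F i).
Proof. by rewrite rmorph_prod horner_prod. Qed.

Lemma transcendental_neq0 : q != 0.
Proof.
apply/negP => /eqP q0; have : 'X = 0 :> {poly int}.
  by apply: ev_eq0; rewrite map_polyX hornerX.
by move/eqP; rewrite polyX_eq0.
Qed.

(** These are the units of [Z[q^-1, q]]. *)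
Definition qunit (z : R[i]) : Prop := exists (e : bool) (k : int), z = (-1) ^+ e * q ^ k.

Lemma qunit1 : qunit 1.
Proof. by exists false, 0; rewrite mul1r. Qed.

Lemma qunitM y z : qunit y -> qunit z -> qunit (y * z).
Proof.
move=> [e [k ->]] [e' [k' ->]]; exists (e (+) e'), (k + k').
by rewrite signr_addb expfzDr ?transcendental_neq0 // mulrACA.
Qed.

Lemma qunit_inv y : qunit y -> qunit y^-1.
Proof.
by move=> [e [k ->]]; exists e, (- k); rewrite invfM -exprVn invrN1 invr_expz.
Qed.

Lemma qunit_prod (I : Type) (l : seq I) (F G H : I -> R[i]) :
  (forall i, exists2 z, qunit z & F i = z * G i) ->
  exists2 z, qunit z & \prod_(i <- l) F i = z * \prod_(i <- l) G i.
Proof.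
move=> FG; elim: l => [|i l [z uz IH]].
  by exists 1; rewrite ?big_nil ?mulr1 //; apply: qunit1.
have [y uy E] := FG i; exists (y * z); first exact: qunitM.
by rewrite !big_cons E IH mulrACA.
Qed.

(** A power of [q] clears a negative exponent. The shape of [U] is recorded because a signed
    monomial vanishes at no root of unity. *)
Lemma qunit_poly z : qunit z ->
  exists (U : {poly int}) (n : nat), z * q ^+ n = ev U /\
    exists (e : bool) (k : nat), U = (-1) ^+ e * 'X^k.
Proof.
move=> [e [k ->]].
have q0 := transcendental_neq0.
case: k => k.
  exists ((-1) ^+ e * 'X^k), 0%N; split; last by exists e, k.
  by rewrite mulr1 evM ev_Xn evX rmorphN rmorph1 !hornerE.
exists ((-1) ^+ e * 'X^0), k.+1; split; last by exists e, 0%N.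
by rewrite evM ev_Xn evX rmorphN rmorph1 !hornerE NegzE -exprnN mulfVK ?expf_neq0.
Qed.

Lemma one_sub_expz (m : int) : m != 0 ->
  exists2 z, qunit z & 1 - q ^ m = z * ev ('X^`|m| - 1).
Proof.
have q0 := transcendental_neq0.
have E n : ev ('X^n - 1) = q ^+ n - 1.
  by rewrite rmorphB /= rmorph1 map_polyXn !hornerE.
case: m => m m0; rewrite E.
  by exists (-1); [exists true, 0; rewrite mulr1 | rewrite mulN1r opprB].
exists (q ^ (Negz m)); first by exists false, (Negz m); rewrite mul1r.
by rewrite mulrBr mulr1 NegzE abszN -exprnN mulVf ?expf_neq0.
Qed.

Lemma prod_qpoch m (r s : 'I_m -> int) n :
  (forall i (k : nat), r i + s i * k%:Z != 0) ->
  exists2 z, qunit z &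
    \prod_(i < m) qpoch q (r i) (s i) n = z * ev (cyclo_prod r s n).
Proof.
move=> hr; rewrite /cyclo_prod ev_prod; apply: qunit_prod => // i.
rewrite ev_prod; apply: qunit_prod => // k; exact: one_sub_expz.
Qed.

Lemma Qratio_cyclo_prod v w (r s : 'I_v -> int) (t u : 'I_w -> int) n :
  (forall i (k : nat), r i + s i * k%:Z != 0) ->
  (forall j (k : nat), t j + u j * k%:Z != 0) ->
  exists2 z, qunit z &
    Qratio r s t u q n = z * (ev (cyclo_prod r s n) / ev (cyclo_prod t u n)).
Proof.
move=> hr ht; have [y uy Ey] := prod_qpoch n hr; have [z uz Ez] := prod_qpoch n ht.
exists (y / z); first by apply: qunitM => //; apply: qunit_inv.
by rewrite /Qratio Ey Ez invfM mulrACA.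
Qed.

Lemma cyclo_prod_neq0 m (r s : 'I_m -> int) n :
  (forall i (k : nat), r i + s i * k%:Z != 0) -> cyclo_prod r s n != 0.
Proof.
move=> hr; rewrite /cyclo_prod.
elim/big_ind: _ => [||i _]; [exact: oner_neq0|exact: mulf_neq0|].
elim/big_ind: _ => [||k _]; [exact: oner_neq0|exact: mulf_neq0|].
by rewrite Xn_sub_1_neq0 // absz_gt0.
Qed.

(** Clearing powers of [q] and lifting to [Z[X]] gives [U * c^n * cyclo_prod r s n = P * 'X^k *
    cyclo_prod t u n]. Neither [U] nor [c] vanishes at [x], so comparing multiplicities there gives
    the inequality. *)
Lemma integral_zero_count v w (r s : 'I_v -> int) (t u : 'I_w -> int)
    (c : {poly int}) n b (x : algC) :
  (forall i (k : nat), r i + s i * k%:Z != 0) ->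
  (forall j (k : nat), t j + u j * k%:Z != 0) ->
  c != 0 -> in_ZqV q (ev c ^+ n * Qratio r s t u q n) ->
  b.-primitive_root x -> ~~ root (map_poly intr c) x ->
  (zero_count t u b n <= zero_count r s b n)%N.
Proof.
move=> hr ht c0 [P [m EP]] xb rx.
have q0 := transcendental_neq0.
have [z uz Ez] := Qratio_cyclo_prod n hr ht.
have [|U [k [EU [e [j Uj]]]]] := @qunit_poly (z * q ^+ m).
  by apply: qunitM => //; exists false, m; rewrite mul1r.
have D0 : ev (cyclo_prod t u n) != 0.
  by apply: contra_neq (cyclo_prod_neq0 n ht); apply: ev_eq0.
have E : U * c ^+ n * cyclo_prod r s n = P * 'X^k * cyclo_prod t u n.
  apply: ev_inj; rewrite !evM evX ev_Xn -EU.
  have -> : ev P = ev c ^+ n * Qratio r s t u q n * q ^+ m.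
    by rewrite EP mulfVK ?expf_neq0.
  by rewrite Ez; field.
have mapi_neq0 (p : {poly int}) : p != 0 -> map_poly intr p != 0 :> {poly algC}.
  by move=> p0; rewrite map_poly_eq0_id0 // intr_eq0 lead_coef_eq0.
have x0 : x != 0 by rewrite (prim_root_eq0 xb) -lt0n (prim_order_gt0 xb).
have rU : ~~ root (map_poly intr (U * c ^+ n)) x.
  rewrite rmorphM /= rmorphXn /= Uj rmorphM /= !rmorphXn /= rmorphN1 /= map_polyX.
  by rewrite /root !hornerE !mulf_neq0 ?expf_neq0 // oppr_eq0 oner_eq0.
have := congr1 (fun p => mup x (map_poly intr p)) E.
rewrite rmorphM mupMr // (mup_cyclo_prod _ xb) // => ->.
rewrite -(mup_cyclo_prod n xb ht) rmorphM mupM ?leq_addl ?mapi_neq0 ?cyclo_prod_neq0 //.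
(* [P] is nonzero because the left-hand side of [E] is. *)
have : P * 'X^k * cyclo_prod t u n != 0.
  rewrite -E mulf_neq0 ?cyclo_prod_neq0 // mulf_neq0 ?expf_neq0 //.
  by rewrite Uj mulf_neq0 ?expf_neq0 ?oppr_eq0 ?oner_eq0 ?polyX_eq0.
by rewrite mulf_eq0 negb_or => /andP[].
Qed.

(** A range [b < M] common to all factors, with exponent 0 off the divisors of [m], allows the
    products to be exchanged later. The index 0 contributes nothing since [m > 0]. *)
Lemma Xn_sub_1_Cyclotomic M m : (0 < m < M)%N ->
  'X^m - 1 = \prod_(b < M) 'Phi_b ^+ (b %| m)%N.
Proof.
case/andP=> m0 mM; rewrite -prod_Cyclotomic //.
rewrite -(big_mkord xpredT (fun b => 'Phi_b ^+ (b %| m)%N)).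
rewrite [RHS](bigID (fun b => b %| m)%N) /= [X in _ * X]big1 ?mulr1; last first.
  by move=> b nbm; rewrite (negPf nbm).
rewrite [RHS](eq_bigr Cyclotomic) => [|b bm]; last by rewrite bm.
rewrite -[RHS]big_filter; apply: perm_big; apply: uniq_perm.
- exact: divisors_uniq.
- by rewrite filter_uniq // iota_uniq.
move=> b; rewrite -dvdn_divisors // mem_filter mem_index_iota /=.
by case: (boolP (b %| m)%N) => //= /dvdn_leq bm; rewrite (leq_ltn_trans (bm m0)).
Qed.

Lemma cyclo_prod_Cyclotomic m (r s : 'I_m -> int) n M :
  (forall i (k : nat), r i + s i * k%:Z != 0) ->
  (forall i (k : 'I_n), (`|(r i + s i * k%:Z)%R| < M)%N) ->
  cyclo_prod r s n = \prod_(b < M) 'Phi_b ^+ zero_count r s b n.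
Proof.
move=> hr hM; rewrite /cyclo_prod.
under eq_bigr => i _ do under eq_bigr => k _ do
  rewrite (@Xn_sub_1_Cyclotomic M) ?hM ?absz_gt0 ?hr //.
under eq_bigr => i _ do rewrite exchange_big /=.
rewrite exchange_big /=; apply: eq_bigr => b _.
by rewrite expr_sum; apply: eq_bigr => i _; rewrite expr_sum.
Qed.

Lemma zero_count_le m (r s : 'I_m -> int) b n : (zero_count r s b n <= m * n)%N.
Proof.
rewrite -[m in (m * _)%N]card_ord -sum_nat_const leq_sum // => i _.
rewrite -[n in leqRHS]card_ord -sum1_card leq_sum // => k _; exact: leq_b1.
Qed.

Lemma zero_count_integral v w (r s : 'I_v -> int) (t u : 'I_w -> int) B0 :
  (forall i (k : nat), r i + s i * k%:Z != 0) ->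
  (forall j (k : nat), t j + u j * k%:Z != 0) ->
  (forall b n, (B0 <= b)%N -> (zero_count t u b n <= zero_count r s b n)%N) ->
  exists C : R[i], [/\ in_Zq q C, C != 0 &
     forall n : nat, in_ZqV q (C ^+ n * Qratio r s t u q n)].
Proof.
move=> hr ht hB.
have q0 := transcendental_neq0.
(* The exponent [w] is enough: each of the [w] progressions contributes at most [n] factors ['Phi_b]
   to the denominator, and [c] is raised to the power [n]. *)
pose c : {poly int} := \prod_(b < B0) 'Phi_b ^+ w.
have c0 : c != 0.
  apply: monic_neq0; apply: monic_prod => b _; apply: monic_exp.
  exact: Cyclotomic_monic.
exists (ev c); split; first by exists c.
  by apply: contra_neq c0; apply: ev_eq0.
move=> n; have [z uz Ez] := Qratio_cyclo_prod n hr ht.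
have [U [k [EU _]]] := qunit_poly uz.
(* [M] exceeds [B0] and every exponent in both products, so one range serves for numerator,
   denominator and [c]. *)
pose M := (B0 + (\sum_(i < v) \sum_(k < n) `|(r i + s i * k%:Z)%R|)
  + (\sum_(i < w) \sum_(k < n) `|(t i + u i * k%:Z)%R|)).+1%N.
have EN : cyclo_prod r s n = \prod_(b < M) 'Phi_b ^+ zero_count r s b n.
  apply: cyclo_prod_Cyclotomic => // i l.
  rewrite /M (bigD1 i) //= (bigD1 l) //=; lia.
have ED : cyclo_prod t u n = \prod_(b < M) 'Phi_b ^+ zero_count t u b n.
  apply: cyclo_prod_Cyclotomic => // i l.
  rewrite /M [X in (_ + X)%N](bigD1 i) //= (bigD1 l) //=; lia.
have Ec : c = \prod_(b < M) 'Phi_b ^+ (if (b < B0)%N then w else 0%N).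
  rewrite /c (big_ord_widen_cond M xpredT (fun b => 'Phi_b ^+ w));
    last by rewrite /M; lia.
  by rewrite [LHS]big_mkcond; apply: eq_bigr => b _ /=; case: (b < B0)%N.
(* The truncated subtraction is exact: for [b < B0] by [zero_count_le], for the other [b] by
   [hB]. *)
pose P : {poly int} := \prod_(b < M) 'Phi_b ^+
  ((if (b < B0)%N then w else 0%N) * n + zero_count r s b n - zero_count t u b n).
have EP : c ^+ n * cyclo_prod r s n = P * cyclo_prod t u n.
  rewrite EN ED Ec -prodrXl -!big_split; apply: eq_bigr => b _ /=.
  rewrite -exprM -!exprD subnK //; case: ltnP => bB.
    by apply: leq_trans (zero_count_le _ _ _ _) (leq_addr _ _).
  by rewrite hB.
have D0 : ev (cyclo_prod t u n) != 0.
  by apply: contra_neq (cyclo_prod_neq0 n ht); apply: ev_eq0.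
exists (U * P), k; rewrite evM -EU.
have -> : ev P = ev c ^+ n * ev (cyclo_prod r s n) / ev (cyclo_prod t u n).
  by rewrite -evX -evM EP evM mulfK.
by rewrite Ez; field; rewrite expf_neq0.
Qed.

End Evaluation.

(** * The Christol order and comparison of counting functions *)

Section Christol.
Variable R : realType.
Implicit Types x y : R.

Lemma cfracP x : exists2 m : int, cfrac x = x - m%:~R & 0 < cfrac x <= 1.
Proof.
rewrite /cfrac; case: ifPn => [/intrP[m ->]|xint].
  (* An integer has normalised fractional part 1, not 0. *)
  by exists (m - 1); [rewrite intrB; ring | rewrite ltr01 lexx].
exists (Num.floor x) => //.
have := floor_itv x; rewrite intrD mulr1z => /andP[fx xf].
have : (Num.floor x)%:~R != x by rewrite -intrEfloor.
move=> fxN; have fx' : (Num.floor x)%:~R < x by rewrite lt_neqAle fxN.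
by apply/andP; split; lra.
Qed.

Lemma cfrac_shift x (m : int) : 0 < x <= 1 -> cfrac (x - m%:~R) = x.
Proof.
move=> x01; have [n -> ] := cfracP (x - m%:~R).
have E : x - m%:~R - n%:~R = x - (m + n)%:~R by rewrite intrD; ring.
rewrite E => c01.
have : (-1)%:~R < (m + n)%:~R :> R by lra.
have : (m + n)%:~R < 1%:~R :> R by lra.
rewrite !ltr_int => h1 h2; suff -> : m + n = 0 by rewrite mulr0z subr0.
lia.
Qed.

Lemma christol_le_trans : transitive (@christol_le R).
Proof.
move=> y x z; rewrite /christol_le.
case/orP => [xy|/andP[/eqP -> xy]] /orP[yz|/andP[/eqP <- yz]].
- by rewrite (lt_trans xy yz).
- by rewrite xy.
- by rewrite yz.
- by rewrite eqxx (le_trans yz xy) orbT.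
Qed.

Lemma christol_le_total : total (@christol_le R).
Proof.
move=> x y; rewrite /christol_le.
by case: (ltgtP (cfrac x) (cfrac y)) => //= _; apply: le_total.
Qed.

(* When the main terms agree, the shifts differ by an integer, so the floors
   compare as the shifts themselves, whatever the positive multiplier [a]. *)
Lemma christol_le_position (b a : nat) (mu mu' al al' : R) (k k' : int) :
  (0 < a)%N -> 0 < mu <= 1 -> 0 < mu' <= 1 ->
  b%:R * mu - al = k%:~R -> b%:R * mu' - al' = k'%:~R ->
  (mu != mu' -> `|al - al'| < b%:R * `|mu - mu'|) ->
  christol_le (mu - (Num.floor (1 - a%:R * al))%:~R)
              (mu' - (Num.floor (1 - a%:R * al'))%:~R) = (k <= k').
Proof.
move=> a0 mu01 mu01' Ek Ek' gap; rewrite /christol_le !cfrac_shift //.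
rewrite -(ler_int R) -Ek -Ek'.
(* When the main terms differ, [gap] makes [b%:R * (mu - mu')] outweigh the difference of the
   shifts, so [k] and [k'] are ordered as [mu] and [mu']. *)
have [lt|gt|E] := ltgtP mu mu'.
- rewrite /=; have /gap : mu != mu' by rewrite lt_eqF.
  rewrite (ltr0_norm (x := mu - mu')) ?subr_lt0 // mulrN mulrBr.
  by have := ler_norm (al' - al); rewrite distrC; symmetry; lra.
- rewrite /=; have /gap : mu != mu' by rewrite gt_eqF.
  rewrite (gtr0_norm (x := mu - mu')) ?subr_gt0 // mulrBr.
  by have := ler_norm (al - al'); move=> *; symmetry; apply/negbTE; rewrite -ltNge; lra.
rewrite /= E lerD2l lerN2 lerD2l lerN2 ler_int.
have -> : al = al' + (k' - k)%:~R by rewrite intrB -Ek -Ek' E; ring.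
set z := k' - k.
have -> : 1 - a%:R * (al' + z%:~R) = 1 - a%:R * al' + (- (a%:Z * z))%:~R.
  by rewrite intrN intrM -pmulrn; ring.
rewrite floorDrz ?intr_int // intrKfloor gerDl oppr_le0 lerDl ler0z.
by rewrite pmulr_rge0.
Qed.

End Christol.

(* Both sides only change at the points [g d], so it suffices to test there. *)
Lemma card_le_test (X : eqType) (le : rel X) (P D : finType) (A : pred P)
    (E : pred D) (f : P -> X) (g : D -> X) (Y : pred X) :
  transitive le -> total le -> (forall d, E d -> Y (g d)) ->
  (forall x, Y x ->
    (#|[set d | E d && le (g d) x]| <= #|[set p | A p && le (f p) x]|)%N) <->
  (forall d0, E d0 ->
    (#|[set d | E d && le (g d) (g d0)]| <= #|[set p | A p && le (f p) (g d0)]|)%N).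
Proof.
move=> tr tot EY; split=> [H d0 /EY /H //|H x _].
have refl : reflexive le by move=> z; have := tot z z; rewrite orbb.
have [->|[d1]] := set_0Vmem [set d | E d && le (g d) x]; first by rewrite cards0.
rewrite inE => d1P.
have total' : total (fun y z => le z y) by move=> y z; apply: tot.
have trans' : transitive (fun y z => le z y) by move=> y z t zy yt; apply: tr yt zy.
(* Replacing [x] by the largest [g d] below it does not lower the count on the left and does not
   raise the one on the right. *)
have [d /andP[Ed dx] dmax] := @extremumP X D (fun y z => le z y) d1
  (fun d => E d && le (g d) x) g refl trans' total' d1P.
apply: leq_trans (_ : #|[set d' | E d' && le (g d') (g d)]| <= _)%N.
  apply: subset_leq_card; apply/subsetP => d'; rewrite !inE => /andP[Ed' d'x].
  by rewrite Ed' dmax // Ed'.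
apply: leq_trans (H d Ed) _; apply: subset_leq_card; apply/subsetP => p.
by rewrite !inE => /andP[-> /tr]; apply.
Qed.

(** * Solutions of [b %| r + s * k] in one period *)

(** For [l < c] this is the normalised fractional part of the [l]-th jump, whose other summand is an
    integer. *)
Definition zero_main (R : realType) (r s : int) (c e l : nat) : R :=
  (cfrac (e%:R * (r%:~R / s%:~R)) + l%:R) / c%:R.

(** The floor only changes the type: under the hypotheses below its argument is an integer. *)
Definition zero_pos (R : realType) (r s : int) (c e b l : nat) : int :=
  Num.floor (b%:R * zero_main R r s c e l - r%:~R / s%:~R).

Section Progression.
Variables (R : realType) (r s : int) (c e b : nat).
Hypotheses (s0 : s != 0) (cE : c = gcdn `|s| b) (cr : (c %| `|r|)%N).
Hypothesis (eE : (b%:Z * e%:Z = c%:Z %[mod s])%Z).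
Hypotheses (rs0 : forall k : nat, r + s * k%:Z != 0) (rsb : (`|r| * `|s| < b)%N).

Local Notation alpha := (r%:~R / s%:~R : R).
Local Notation mu := (zero_main R r s c e).
Local Notation pos := (zero_pos R r s c e b).

Let b0 : (0 < b)%N. Proof. by apply: leq_ltn_trans rsb. Qed.
Let c0 : (0 < c)%N. Proof. by rewrite cE gcdn_gt0 b0 orbT. Qed.

Lemma zero_main_itv l : (l < c)%N -> 0 < mu l <= 1.
Proof.
move=> lc; have [_ _ /andP[g0 g1]] := cfracP (e%:R * alpha).
have c0R : 0 < c%:R :> R by rewrite ltr0n.
have l0 : 0 <= l%:R :> R by [].
have lc' : l%:R + 1 <= c%:R :> R by rewrite natr1 ler_nat.
by rewrite /zero_main divr_gt0 ?ler_pdivrMr //=; lra.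
Qed.

(** Write [b * e = c + z * s] and [cfrac (e * alpha) = e * alpha - g]. Then [b * mu l - alpha = (b *
    e / c - 1) * alpha + (b / c) * (l - g)], whose first term is [z * r / c]; everything is an
    integer since [c] divides [r], [s] and [b]. *)
Lemma zero_pos_spec : exists (r' s' b' g z : int),
  [/\ r = c%:Z * r', s = c%:Z * s', b%:Z = c%:Z * b' &
   forall l : nat, [/\ mu l * s%:~R = (e%:Z * r' + s' * (l%:Z - g))%:~R,
     b%:R * mu l - alpha = (pos l)%:~R, pos l = z * r' + b' * (l%:Z - g) &
     r + s * pos l = b%:Z * (e%:Z * r' + s' * (l%:Z - g))]].
Proof.
have /dvdzP [r' Er] : (c%:Z %| r)%Z by rewrite dvdzE.
have /dvdzP [s' Es] : (c%:Z %| s)%Z by rewrite dvdzE cE dvdn_gcdl.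
have /dvdzP [b' Eb] : (c%:Z %| b%:Z)%Z by rewrite dvdzE cE dvdn_gcdr.
have /dvdzP [z Ez] : (s %| b%:Z * e%:Z - c%:Z)%Z by rewrite -eqz_mod_dvd eE.
have [g Eg _] := cfracP (e%:R * alpha).
have cR : c%:R != 0 :> R by rewrite pnatr_eq0 -lt0n.
have sR : s%:~R != 0 :> R by rewrite intr_eq0.
have s'R : s'%:~R != 0 :> R.
  by move: sR; rewrite Es intrM mulf_eq0 negb_or => /andP[].
have EzR : b%:R * e%:R = c%:R + z%:~R * s%:~R :> R.
  rewrite -intrM -Ez intrB intrM -!pmulrn; ring.
exists r', s', b', g, z; split; [by rewrite mulrC|by rewrite mulrC|by rewrite mulrC|].
have key l : b%:R * mu l - alpha = (z * r' + b' * (l%:Z - g))%:~R.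
  have -> : b%:R * mu l - alpha =
     (b%:R * e%:R) / c%:R * alpha - alpha + b%:R / c%:R * (l%:R - g%:~R).
    by rewrite /zero_main Eg; field; rewrite sR cR.
  rewrite EzR; have -> : b%:R = b'%:~R * c%:R :> R by rewrite pmulrn Eb intrM.
  rewrite Er !intrD !intrM intrB -!pmulrn; field.
  by rewrite sR cR.
move=> l; split.
- rewrite /zero_main Eg Er Es !intrD !intrM intrB -!pmulrn; field.
  by rewrite s'R cR.
- by rewrite /zero_pos key intrKfloor.
- by rewrite /zero_pos key intrKfloor.
rewrite /zero_pos key intrKfloor.
have Esb : s' * (b' * c%:Z) = s * b' by rewrite [in RHS]Es; ring.
transitivity (r' * c%:Z + (b%:Z * e%:Z - c%:Z) * r' + s' * (b' * c%:Z) * (l%:Z - g)).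
  by rewrite Ez -Er Esb; ring.
rewrite -Eb; ring.
Qed.

(** [mu l * |s|] is a positive integer and [|alpha| < b / |s|]. Hence [mu l >= 1 / |s|] gives the
    lower bound and, if [mu l < 1], [mu l <= 1 - 1 / |s|] gives the upper one. *)
Lemma zero_pos_itv l : (l < c)%N -> 0 <= pos l < b%:Z.
Proof.
move=> lc; have [r' [s' [b' [g [z [_ _ _ H]]]]]] := zero_pos_spec.
have [mus posE _ _] := H l; have /andP[mu0 mu1] := zero_main_itv lc.
have sR : 0 < `|s|%:~R :> R by rewrite ltr0z normr_gt0.
have s1 : 1 <= `|s|%:~R :> R by rewrite ler1z -gtz0_ge1 normr_gt0.
have [m Em] : exists m : int, mu l * `|s|%:~R = m%:~R.
  exists `|e%:Z * r' + s' * (l%:Z - g)|; rewrite !intr_norm -mus normrM.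
  by rewrite (gtr0_norm mu0).
have alE : `|alpha| * `|s|%:~R = `|r|%:~R.
  by rewrite normrM normfV !intr_norm mulfVK // normr_eq0 intr_eq0.
have bR : `|r|%:~R * `|s|%:~R < b%:R :> R.
  by rewrite -intrM pmulrn ltr_int; move: rsb; clear; lia.
have r_al : `|alpha| <= `|r|%:~R.
  by rewrite -alE ler_peMr.
have bs : `|alpha| * `|s|%:~R * `|s|%:~R < b%:R by rewrite alE.
have al2 : `|alpha| * `|s|%:~R <= `|alpha| * `|s|%:~R * `|s|%:~R.
  by rewrite ler_peMr // mulr_ge0 // ltW.
have b0R : 0 < b%:R :> R by rewrite ltr0n.
have m1 : 1 <= mu l * `|s|%:~R.
  have : 0 < m%:~R :> R by rewrite -Em mulr_gt0.
  by rewrite Em ltr0z ler1z gtz0_ge1.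
have al_b : `|alpha| * `|s|%:~R < b%:R * (mu l * `|s|%:~R).
  by apply: lt_le_trans (_ : b%:R <= _); [lra | rewrite ler_peMr // ltW].
have abs1 := ler_norm alpha; have abs2 := ler_norm (- alpha); rewrite normrN in abs2.
rewrite -!(ltr_int R) -!(ler_int R) -posE -pmulrn.
apply/andP; split.
  rewrite subr_ge0 (le_trans abs1) // -(ler_pM2r sR); lra.
move: mu1; rewrite le_eqVlt => /orP[/eqP E1|mu1].
  (* Here the position is [b - alpha] and [alpha] is an integer; [alpha <= 0] would make
     [k = - alpha] a zero of [r + s * k], against [rs0]. *)
  rewrite E1 mulr1 gtrBl.
  have Eal : alpha = (b%:Z - pos l)%:~R by rewrite intrB -posE E1 -pmulrn; ring.
  rewrite Eal ltr0z ltNge; apply/negP => al0.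
  have : r%:~R = (b%:Z - pos l)%:~R * s%:~R :> R.
    by rewrite -Eal mulfVK // intr_eq0.
  rewrite -intrM => /intr_inj Er.
  have := rs0 `|b%:Z - pos l|%N; rewrite abszE ler0_norm // => /eqP; apply.
  rewrite [X in X + _]Er; ring.
have m2 : mu l * `|s|%:~R <= `|s|%:~R - 1.
  have : m%:~R < `|s|%:~R :> R by rewrite -Em gtr_pMl.
  rewrite Em ltr_int => ms; rewrite -[1]/(1%:~R) -intrB ler_int.
  by move: ms; clear; lia.
have : b%:R * (mu l * `|s|%:~R) <= b%:R * (`|s|%:~R - 1) by rewrite ler_pM2l.
move=> m3; rewrite ltrBlDr -(ltr_pM2r sR).
have : - alpha * `|s|%:~R <= `|alpha| * `|s|%:~R by rewrite ler_pM2r.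
lra.
Qed.

(** As [b / c] and [s / c] are coprime, the solutions form a single class modulo [b / c], and the
    [pos l] are its successive members. *)
Lemma zero_pos_surj (k : nat) : (k < b)%N -> (b %| `|(r + s * k%:Z)%R|)%N ->
  exists2 l : 'I_c, pos l = k & forall l' : 'I_c, pos l' = k -> l' = l.
Proof.
move=> kb bk.
have [r' [s' [b' [g [z [Er Es Eb H]]]]]] := zero_pos_spec.
have [_ _ P0 D0] := H 0%N.
have posD l : pos l = pos 0%N + b' * l%:Z.
  by have [_ _ -> _] := H l; rewrite P0; ring.
have b'0 : 0 < b' by move: b0 c0 Eb; clear; nia.
have cop : coprimez b' s'.
  have : (c * gcdn `|s'| `|b'| = c * 1)%N.
    by rewrite muln_gcdr -!(abszM c) -Es -Eb muln1 cE.
  by move/eqP; rewrite eqn_pmul2l // gcdnC => /eqP E; rewrite /coprimez /gcdz E.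
have /dvdzP [j Ej] : (b' %| k%:Z - pos 0%N)%Z.
  rewrite -(Gauss_dvdzr _ cop).
  have : (b%:Z %| s * (k%:Z - pos 0%N))%Z.
    have -> : s * (k%:Z - pos 0%N) = (r + s * k%:Z) - (r + s * pos 0%N) by ring.
    by rewrite D0 rpredB ?dvdz_mulr // dvdzE.
  by rewrite Eb Es -mulrA dvdz_mul2l // -?lt0n.
have /andP[p0 _] := zero_pos_itv c0.
have /andP[_ pc] : 0 <= pos c.-1 < b%:Z by apply: zero_pos_itv; rewrite prednK.
rewrite posD in pc.
have Ec : c%:Z = c.-1%:Z + 1 by move: c0; clear; lia.
(* From [pos 0 + b' * (c - 1) < b' * c]: so [pos 0] is the least nonnegative member of the class,
   which forces [j >= 0]. *)
have pb : pos 0%N < b' by move: pc; rewrite Eb Ec mulrDl mul1r mulrC; clear; lia.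
have j0 : 0 <= j.
  by rewrite leNgt; apply/negP => jn; move: Ej p0 pb b'0 jn; clear; nia.
have jc : j < c%:Z.
  rewrite -(ltr_pM2r b'0) -Eb -Ej; move: kb p0; clear; lia.
have jc' : (`|j| < c)%N by move: j0 jc; clear; lia.
exists (Ordinal jc').
  by rewrite posD /= abszE ger0_norm // mulrC -Ej addrC subrK.
move=> l'; rewrite posD => El; apply: val_inj => /=.
have : b' * l'%:Z = b' * j by rewrite [RHS]mulrC -Ej -El addrC addKr.
by move/(mulfI (lt0r_neq0 b'0)) => <-.
Qed.

Lemma sum_dvdn_zero_pos n : (n <= b)%N ->
  (\sum_(k < n) (b %| `|(r + s * k%:Z)%R|) = \sum_(l < c) (pos l < n%:Z)%R)%N.
Proof.
move=> nb.
have posE (l : 'I_c) : (pos l < n%:Z)%R = (\sum_(k < n) (pos l == k%:Z)%R)%N :> nat.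
  have /andP[] := zero_pos_itv (ltn_ord l); case: (pos l) => // p _ _.
  have [pn|np] := ltnP p n.
    rewrite (bigD1 (Ordinal pn)) //= eqxx big1 ?ltz_nat ?pn // => k kp.
    by apply/eqP; rewrite eqb0; apply: contraNneq kp => -[/esym kp]; apply/eqP/val_inj.
  rewrite big1 ?ltz_nat ?ltnNge ?np // => k _; apply/eqP; rewrite eqb0.
  by apply/eqP => -[pk]; move: np; rewrite pk leqNgt ltn_ord.
under [RHS]eq_bigr do rewrite posE.
rewrite exchange_big; apply: eq_bigr => k _ /=.
have kb : (k < b)%N by apply: leq_trans nb.
have [bk|bk] := boolP (_ %| _)%N.
  have [l El lun] := zero_pos_surj kb bk.
  rewrite (bigD1 l) //= El eqxx big1 // => l' l'l.
  by apply/eqP; rewrite eqb0; apply: contra_neqN l'l => /eqP; apply: lun.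
rewrite big1 // => l _; apply/eqP; rewrite eqb0; apply: contraNN bk => /eqP El.
have [r' [s' [b' [g [z [_ _ _ H]]]]]] := zero_pos_spec.
have [_ _ _ ] := H l; rewrite El => ->.
by rewrite abszM dvdn_mulr.
Qed.

End Progression.

(** * Families of progressions, for the modulus [b + d * N] *)

Section Family.
Variables (R : realType) (m : nat) (r s : 'I_m -> int) (e : 'I_m -> nat).
Variables (b d N T : nat).
Hypotheses (s0 : forall i, s i != 0) (sd : forall i, (`|s i| %| d)%N).
Hypotheses (rs0 : forall i (k : nat), r i + s i * k%:Z != 0).
Hypotheses (rT : forall i, (`|r i| <= T)%N) (sT : forall i, (`|s i| <= T)%N).
Hypotheses (he : is_e r s b e) (Tb : (T * T * 2 < b + d * N)%N).

Local Notation B := (b + d * N)%N.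
Local Notation c := (gcd3 r s b).

Lemma gcdn_progression i : gcdn `|s i| B = gcdn `|s i| b.
Proof.
case/dvdnP: (sd i) => k ->.
by rewrite addnC mulnAC gcdnMDl.
Qed.

Lemma Vset_gcd i : i \in Vset r s b -> c i = gcdn `|s i| B.
Proof. by rewrite inE gcdn_progression => /eqP. Qed.

Lemma gcd3_dvd i : (c i %| `|r i|)%N.
Proof. by rewrite /gcd3 -gcdnA dvdn_gcdl. Qed.

Lemma is_e_progression i : i \in Vset r s b ->
  (B%:Z * (e i)%:Z = (c i)%:Z %[mod s i])%Z.
Proof.
move=> iV; have [_ <-] := he iV; apply/eqP; rewrite eqz_mod_dvd.
rewrite -mulrBl PoszD [b%:Z + _]addrC addrK PoszM -mulrA.
by rewrite dvdz_mulr // dvdzE; apply: sd.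
Qed.

Lemma size_lt_progression i : (`|r i| * `|s i| < B)%N.
Proof.
apply: leq_ltn_trans Tb; apply: leq_trans (leq_mul (rT i) (sT i)) _.
by rewrite leq_pmulr.
Qed.

Lemma zero_count_small n : (n <= B)%N ->
  zero_count r s B n = #|[set p : {i : 'I_m & 'I_(c i)} | (tag p \in Vset r s b) &&
    (zero_pos R (r (tag p)) (s (tag p)) (c (tag p)) (e (tag p)) B (tagged p) < n%:Z)%R]|.
Proof.
move=> nB; rewrite -sum1_card.
under [RHS]eq_bigl => p do rewrite inE.
rewrite -(sig_big_dep (J := fun i => 'I_(c i)) (fun i => i \in Vset r s b)
  (fun i (l : 'I_(c i)) => zero_pos R (r i) (s i) (c i) (e i) B l < n%:Z)%R
  (fun _ _ => 1%N)) /=.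
rewrite [RHS]big_mkcond; apply: eq_bigr => i _; case: ifPn => [iV|iV].
  rewrite (sum_dvdn_zero_pos R (s0 i) (Vset_gcd iV) (gcd3_dvd i) (is_e_progression iV)
    (rs0 i) (size_lt_progression i) nB).
  by rewrite [RHS]big_mkcond; apply: eq_bigr => l _; case: ifP.
(* Off [Vset] nothing is counted: if [B] divided [r i + s i * k], then [gcdn |s i| b] would divide
   [r i]. *)
apply: big1 => k _; apply/eqP; rewrite eqb0; apply: contra iV => Bk.
rewrite inE eqn_dvd /gcd3; apply/andP; split; last first.
  by rewrite dvdn_gcd dvdn_gcdr (dvdn_trans (dvdn_gcdl _ _)) ?dvdn_gcdr.
have gs : (gcdn `|s i| b %| `|s i|)%N by apply: dvdn_gcdl.
rewrite !dvdn_gcd gs dvdn_gcdr !andbT.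
have : ((gcdn `|s i| b)%:Z %| r i + s i * k%:Z)%Z.
  by rewrite dvdzE; apply: dvdn_trans Bk; rewrite -gcdn_progression dvdn_gcdr.
by rewrite rpredDr ?dvdz_mulr // dvdzE.
Qed.

Lemma zero_count_add n :
  zero_count r s B (B + n) = (zero_count r s B B + zero_count r s B n)%N.
Proof.
rewrite /zero_count -big_split; apply: eq_bigr => i _.
rewrite big_split_ord; congr (_ + _)%N; apply: eq_bigr => k _ /=.
congr nat_of_bool.
have E x : (B %| `|x|)%N = (B%:Z %| x)%Z by rewrite dvdzE.
rewrite !E; have -> : r i + s i * (B + k)%N%:Z = s i * B%:Z + (r i + s i * k%:Z).
  by rewrite PoszD; ring.
by rewrite rpredDl // dvdz_mull.
Qed.

End Family.

(** * Jumps in Christol order against zeros in natural order *)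

Section JumpOrder.
Variables (R : realType) (v w : nat) (r s : 'I_v -> int) (t u : 'I_w -> int).
Variables (e : 'I_v -> nat) (f : 'I_w -> nat) (a b d N T : nat).
Hypothesis a0 : (0 < a)%N.
Hypotheses (s0 : forall i, s i != 0) (u0 : forall j, u j != 0).
Hypotheses (sd : forall i, (`|s i| %| d)%N) (ud : forall j, (`|u j| %| d)%N).
Hypotheses (rT : forall i, (`|r i| <= T)%N) (sT : forall i, (`|s i| <= T)%N).
Hypotheses (tT : forall j, (`|t j| <= T)%N) (uT : forall j, (`|u j| <= T)%N).
Hypotheses (he : is_e r s b e) (hf : is_e t u b f).
Hypothesis Tb : (T * T * 2 < b + d * N)%N.

Local Notation B := (b + d * N)%N.

(** Main terms have denominators dividing [s i] and [u j], so distinct ones differ by at least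
    [1 / |s i * u j|]. The shifts differ by [|r i * u j - t j * s i| / |s i * u j|], with numerator
    at most [2 T^2 < B]; this is the gap that [christol_le_position] asks for. *)
Lemma christol_le_jump i j (k : 'I_(gcd3 r s b i)) (l : 'I_(gcd3 t u b j)) :
  i \in Vset r s b -> j \in Vset t u b ->
  christol_le (jump R r s b a e i k) (jump R t u b a f j l) =
  (zero_pos R (r i) (s i) (gcd3 r s b i) (e i) B k <=
   zero_pos R (t j) (u j) (gcd3 t u b j) (f j) B l).
Proof.
move=> iV jV.
have [r' [s' [b' [g [z [_ _ _ H]]]]]] :=
  zero_pos_spec R (s0 i) (Vset_gcd N sd iV) (gcd3_dvd r s b i)
  (is_e_progression N sd he iV) (size_lt_progression rT sT Tb i).
have [t' [u' [b'' [g' [z' [_ _ _ H']]]]]] :=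
  zero_pos_spec R (u0 j) (Vset_gcd N ud jV) (gcd3_dvd t u b j)
  (is_e_progression N ud hf jV) (size_lt_progression tT uT Tb j).
have [Em Ek _ _] := H k; have [Em' Ek' _ _] := H' l.
apply: (@christol_le_position R B a _ _ _ _ _ _ a0 _ _ Ek Ek').
- exact: (zero_main_itv R _ (Vset_gcd N sd iV)
    (size_lt_progression rT sT Tb i) (ltn_ord k)).
- exact: (zero_main_itv R _ (Vset_gcd N ud jV)
    (size_lt_progression tT uT Tb j) (ltn_ord l)).
set mu := zero_main _ _ _ _ _ _ in Em *; set mu' := zero_main _ _ _ _ _ _ in Em' *.
move=> mumu'.
have sR : (s i)%:~R != 0 :> R by rewrite intr_eq0.
have uR : (u j)%:~R != 0 :> R by rewrite intr_eq0.
have suR : 0 < `|(s i)%:~R * (u j)%:~R| :> R by rewrite normr_gt0 mulf_neq0.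
rewrite -(ltr_pM2r suR) -mulrA -!normrM.
have [x Ex] : exists x : int, mu * (s i)%:~R = x%:~R by eexists; exact: Em.
have [y Ey] : exists y : int, mu' * (u j)%:~R = y%:~R by eexists; exact: Em'.
have -> : (mu - mu') * ((s i)%:~R * (u j)%:~R) = (x * u j - y * s i)%:~R.
  by rewrite intrB !intrM -Ex -Ey; ring.
have xy : x * u j - y * s i != 0.
  apply: contraNneq mumu' => /(congr1 (intr : int -> R)) /eqP.
  rewrite intrB !intrM -Ex -Ey mulr0z.
  have -> : mu * (s i)%:~R * (u j)%:~R - mu' * (u j)%:~R * (s i)%:~R =
    (mu - mu') * ((s i)%:~R * (u j)%:~R) by ring.
  by rewrite !mulf_eq0 (negPf sR) (negPf uR) !orbF subr_eq0.
have -> : ((r i)%:~R / (s i)%:~R - (t j)%:~R / (u j)%:~R) * ((s i)%:~R * (u j)%:~R)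
   = (r i * u j - t j * s i)%:~R :> R.
  by rewrite intrB !intrM; field; rewrite sR uR.
rewrite -!intr_norm; apply: lt_le_trans (_ : B%:R <= _).
  rewrite pmulrn ltr_int; apply: le_lt_trans (ler_normB _ _) _.
  rewrite !normrM -!abszE -!PoszM -PoszD ltz_nat.
  apply: leq_ltn_trans Tb; rewrite muln2 -addnn.
  by apply: leq_add; apply: leq_mul.
by rewrite ler_peMr // ler1z -gtz0_ge1 normr_gt0.
Qed.

End JumpOrder.

(** * Nonnegativity of [Xi] as an inequality between zero counts *)

Section Comparison.
Variables (R : realType) (v w : nat) (r s : 'I_v -> int) (t u : 'I_w -> int).
Variables (e : 'I_v -> nat) (f : 'I_w -> nat) (a b d N T : nat).
Hypothesis a0 : (0 < a)%N.
Hypotheses (s0 : forall i, s i != 0) (u0 : forall j, u j != 0).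
Hypotheses (sd : forall i, (`|s i| %| d)%N) (ud : forall j, (`|u j| %| d)%N).
Hypotheses (rs0 : forall i (k : nat), r i + s i * k%:Z != 0).
Hypotheses (tu0 : forall j (k : nat), t j + u j * k%:Z != 0).
Hypotheses (rT : forall i, (`|r i| <= T)%N) (sT : forall i, (`|s i| <= T)%N).
Hypotheses (tT : forall j, (`|t j| <= T)%N) (uT : forall j, (`|u j| <= T)%N).
Hypotheses (he : is_e r s b e) (hf : is_e t u b f).
Hypothesis (Tb : (T * T * 2 < b + d * N)%N).

Local Notation B := (b + d * N)%N.

Lemma zero_count_periodic :
  (forall n, (n <= B)%N -> (zero_count t u B n <= zero_count r s B n)%N) ->
  forall n, (zero_count t u B n <= zero_count r s B n)%N.
Proof.
move=> H; elim/ltn_ind => n IH; have [/H //|Bn] := leqP n B.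
rewrite -(subnKC (ltnW Bn)) !zero_count_add //.
by apply: leq_add; [apply: H | apply: IH; lia].
Qed.

(** Both conditions compare counting functions, so by [card_le_test] they need testing only at the
    jumps, respectively zeros, coming from [(t, u)]. There [christol_le_jump] identifies the counted
    sets. *)
Lemma Xi_zero_count :
  (forall x : R, 0 <= Xi r s t u b a e f x) <->
  (forall n, (zero_count t u B n <= zero_count r s B n)%N).
Proof.
pose VP := fun p : {i : 'I_v & 'I_(gcd3 r s b i)} => tag p \in Vset r s b.
pose VD := fun p : {j : 'I_w & 'I_(gcd3 t u b j)} => tag p \in Vset t u b.
pose jP (p : {i : 'I_v & 'I_(gcd3 r s b i)}) : R :=
  jump R r s b a e (tag p) (tagged p : 'I_(gcd3 r s b (tag p))).
pose jD (p : {j : 'I_w & 'I_(gcd3 t u b j)}) : R :=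
  jump R t u b a f (tag p) (tagged p : 'I_(gcd3 t u b (tag p))).
pose zP (p : {i : 'I_v & 'I_(gcd3 r s b i)}) :=
  zero_pos R (r (tag p)) (s (tag p)) (gcd3 r s b (tag p)) (e (tag p)) B (tagged p).
pose zD (p : {j : 'I_w & 'I_(gcd3 t u b j)}) :=
  zero_pos R (t (tag p)) (u (tag p)) (gcd3 t u b (tag p)) (f (tag p)) B (tagged p).
have zD_itv p : VD p -> 0 <= zD p < B%:Z.
  move=> pV; apply: zero_pos_itv (ltn_ord (tagged p)) => //.
  - exact: Vset_gcd.
  - exact: gcd3_dvd.
  - exact: is_e_progression.
  - exact: size_lt_progression.
have H1 := card_le_test VP jP (@christol_le_trans R) (@christol_le_total R)
   (fun d (_ : VD d) => isT : predT (jD d)).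
(* Test values are confined to one period, where [zero_count_small] applies; periodicity covers the
   larger [n]. *)
have H2 := card_le_test VP zP (@le_trans _ int) (@le_total _ int) 
   (E := VD) (g := zD) (Y := fun x => 0 <= x < B%:Z) zD_itv.
have test : (forall d0, VD d0 -> (#|[set d | VD d && christol_le (jD d) (jD d0)]|
      <= #|[set p | VP p && christol_le (jP p) (jD d0)]|)%N) <->
   (forall d0, VD d0 -> (#|[set d | VD d && (zD d <= zD d0)%R]|
      <= #|[set p | VP p && (zP p <= zD d0)%R]|)%N).
  suff E d0 : VD d0 ->
     [set d | VD d && christol_le (jD d) (jD d0)] = [set d | VD d && (zD d <= zD d0)] /\
     [set p | VP p && christol_le (jP p) (jD d0)] = [set p | VP p && (zP p <= zD d0)].
    by split=> H d0 d0V; have [E1 E2] := E d0 d0V; have := H d0 d0V; rewrite E1 E2.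
  move=> d0V; split; apply/setP => p; rewrite !inE; apply: andb_id2l => pV.
    exact: (christol_le_jump _ _ _ _ _ _ _ _ _ _ _ _ Tb).
  exact: (christol_le_jump _ _ _ _ _ _ _ _ _ _ _ _ Tb).
(* Positions [< n + 1] are positions [<= n], the form that [card_le_test] uses. *)
have cP n : (n < B)%N -> zero_count r s B n.+1 = #|[set p | VP p && (zP p <= n%:Z)]|.
  by move=> nB; rewrite (zero_count_small R s0 sd rs0 rT sT he Tb) //.
have cD n : (n < B)%N -> zero_count t u B n.+1 = #|[set p | VD p && (zD p <= n%:Z)]|.
  by move=> nB; rewrite (zero_count_small R u0 ud tu0 tT uT hf Tb) //.
split=> H.
  apply: zero_count_periodic => -[|n] nB.
    by rewrite /zero_count !big1 // => i _; rewrite big_ord0.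
  rewrite cP // cD //; apply: H2.2; last by rewrite ltz_nat.
  by apply/test/H1 => x _; have := H x; rewrite /Xi subr_ge0 lez_nat.
move=> x; rewrite /Xi subr_ge0 lez_nat; apply: (H1.2 _ x isT).
apply/test/H2 => -[|//] n /andP[_]; rewrite ltz_nat => nB.
by rewrite -cP // -cD.
Qed.

End Comparison.

(** * The equivalence, one residue modulo [d] at a time *)

Theorem theorem5p5 (R : realType) (q : R[i]) (v w : nat)
    (r s : 'I_v -> int) (t u : 'I_w -> int)
    (hq : transcendental q)
    (hs : forall i, s i != 0) (hu : forall j, u j != 0)
    (hwd : Qratio_well_defined t u q)
    (hnz : ~ eventually_zero (Qratio r s t u q))
    (a : nat -> nat) (e : nat -> 'I_v -> nat) (f : nat -> 'I_w -> nat)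
    (ha : forall b, (1 <= b <= drt s u)%N -> is_a s u b (a b))
    (he : forall b, (1 <= b <= drt s u)%N -> is_e r s b (e b))
    (hf : forall b, (1 <= b <= drt s u)%N -> is_e t u b (f b)) :
  (exists C : R[i], [/\ in_Zq q C, C != 0 &
     forall n : nat, in_ZqV q (C ^+ n * Qratio r s t u q n)])
  <->
  (forall b : nat, (1 <= b <= drt s u)%N ->
     forall x : R, 0 <= Xi r s t u b (a b) (e b) (f b) x).
Proof.
(* A zero factor stays in all later products: in the numerator this contradicts [hnz], in the
   denominator [hwd]. *)
have vanish m (r' s' : 'I_m -> int) i (k : nat) : r' i + s' i * k%:Z = 0 ->
    forall n, (k < n)%N -> \prod_(j < m) qpoch q (r' j) (s' j) n = 0.
  move=> E n kn; rewrite (bigD1 i) //= /qpoch (bigD1 (Ordinal kn)) //= E expr0z.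
  by rewrite subrr !mul0r.
have hr i (k : nat) : r i + s i * k%:Z != 0.
  apply/eqP => E; apply: hnz; exists k.+1 => n kn.
  by rewrite /Qratio (vanish _ _ _ _ _ E) // mul0r.
have ht j (k : nat) : t j + u j * k%:Z != 0.
  by apply/eqP => E; have := hwd k.+1; rewrite (vanish _ _ _ _ _ E) // eqxx.
set d := drt s u.
have d0 : (0 < d)%N := drt_gt0 hs hu.
have sd i : (`|s i| %| d)%N.
  by apply: dvdn_trans (dvdn_lcml _ _); apply: (biglcmn_sup i).
have ud j : (`|u j| %| d)%N.
  by apply: dvdn_trans (dvdn_lcmr _ _); apply: (biglcmn_sup j).
pose T := (\sum_i `|r i| + \sum_i `|s i| + \sum_j `|t j| + \sum_j `|u j|)%N.
have rT i : (`|r i| <= T)%N by rewrite /T (bigD1 i) //= -!addnA leq_addr.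
have sT i : (`|s i| <= T)%N.
  by rewrite /T [X in (_ + X + _ + _)%N](bigD1 i) //=; clear; lia.
have tT j : (`|t j| <= T)%N.
  by rewrite /T [X in (_ + X + _)%N](bigD1 j) //=; clear; lia.
have uT j : (`|u j| <= T)%N.
  by rewrite /T [X in (_ + X)%N](bigD1 j) //=; clear; lia.
have XiP b N : (1 <= b <= d)%N -> (T * T * 2 < b + d * N)%N ->
  (forall x : R, 0 <= Xi r s t u b (a b) (e b) (f b) x) <->
  (forall n, (zero_count t u (b + d * N) n <= zero_count r s (b + d * N) n)%N).
  move=> bd Tb; have [/andP[a0 _] _] := ha b bd.
  exact: (Xi_zero_count R a0 hs hu sd ud hr ht rT sT tT uT (he b bd) (hf b bd) Tb).
split=> [[C [[c ->] C0 HC]] b bd | H].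
  have /andP[b0 _] := bd.
  have c0 : c != 0 by apply: contraNneq C0 => ->; rewrite rmorph0 horner0.
  (* One large order congruent to [b] modulo [d] suffices, since the left side of [XiP] does not
     involve [N]. *)
  have [N [z [TN zN rz]]] := prim_root_avoid (T * T * 2) c0 b0 d0.
  apply/(XiP b N bd); first by move: d0 TN b0; clear; nia.
  by move=> n; apply: (integral_zero_count hq hr ht c0 (HC n) zN rz).
apply: (zero_count_integral hq (B0 := (T * T * 2).+1) hr ht) => B n TB.
(* Shifting by one puts the residue of [B] in [1..d] instead of [0..d-1]. *)
pose b := (B.-1 %% d).+1.
have bd : (1 <= b <= d)%N by rewrite /= ltn_pmod.
have EB : B = (b + d * (B.-1 %/ d))%N.
  by rewrite /b addSn addnC mulnC -divn_eq prednK //; apply: leq_ltn_trans TB.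
have := XiP b (B.-1 %/ d)%N bd; rewrite -EB => /(_ TB) [Xi_le _].
exact/Xi_le/H.
Qed.
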